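(* Let $\{S(t): t\ge 0\}$ be a semigroup on a metric space $(V,d)$, $T>0$ and let $B\subseteq V$ be a nonempty bounded set such that $S(T)B\subseteq B$. If the semigroup is quasi-stable on $B$ at time $T$ with respect to a compact seminorm $\mathfrak{n}_Z$ and parameters $(\eta,\kappa)$, then for any $\sigma\in(0,1-\eta)$ there exist $k_0\in\mathbb{N}$ and $a,b>0$ such that the covering condition $$N^{V}(S(kT)B,aq^{k})\le b h^{k},\quad k\in\mathbb{N},\ k\ge k_0,$$ is satisfied with $q=\eta+\sigma$ and $h=\mathfrak{m}_{Z}\left(\tfrac{\sigma}{2\kappa}\right)$.
   Context: $\mathbb{N}=\{1,2,\dots\}$. A semigroup $\{S(t):t\ge0\}$ on a metric space $(V,d)$ is a family of maps $S(t):V\to V$ with $S(t)S(s)=S(t+s)$ for $t,s\ge 0$ and $S(0)=I$; ''$t\ge 0$'' means throughout either $t\in[0,\infty)$ or $t\in\mathbb{N}\cup\{0\}$ (and $T$ belongs to the time set). A compact seminorm on a normed space $Z$ is a seminorm $\mathfrak{n}_Z:Z\to[0,\infty)$ such that any bounded sequence $z_k\in Z$ has a subsequence $z_{k_j}$ with $\mathfrak{n}_Z(z_{k_j}-z_{k_l})\to0$ as $j,l\to\infty$. The semigroup is quasi-stable on a set $B\subseteq V$ at time $T>0$ with respect to a compact seminorm $\mathfrak{n}_Z$ and parameters $(\eta,\kappa)$ if $\eta\in[0,1)$, $\kappa>0$ and there is a map $K:B\to Z$ into the normed space $Z$ (on which $\mathfrak{n}_Z$ is a compact seminorm) such that for all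 $x,y\in B$ $$\|Kx-Ky\|_Z\le\kappa\, d(x,y),\qquad d(S(T)x,S(T)y)\le\eta\, d(x,y)+\mathfrak{n}_Z(Kx-Ky).$$ $\mathfrak{m}_Z(\mu)$ denotes the maximal cardinality of a subset $U$ of the closed unit ball $\overline{B}^Z(0,1)=\{z\in Z:\|z\|_Z\le1\}$ such that $\mathfrak{n}_Z(x-y)\ge\mu$ for all $x,y\in U$, $x\ne y$. $N^V(G,\varepsilon)$ is the minimal number of open $\varepsilon$-balls in $V$ centered at points of $G$ needed to cover $G\subseteq V$. *)

(* Defs.v *)
From HB Require Import structures.
From mathcomp Require Export all_boot all_order all_algebra.
From mathcomp Require Export all_classical all_reals all_analysis.
Export numFieldNormedType.Exports.

Set Implicit Arguments.
Unset Strict Implicit.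
Unset Printing Implicit Defensive.

Import Order.TTheory GRing.Theory Num.Theory.
Local Open Scope classical_set_scope.
Local Open Scope ring_scope.

Variant time_kind := continuous_time | discrete_time.

Definition time_set (R : realType) (tk : time_kind) : set R :=
  match tk with
  | continuous_time => [set t | 0 <= t]
  | discrete_time => range (fun n : nat => n%:R)
  end.

(* [S] is a total function on [R]; its values outside the time set are
   irrelevant. *)
Definition semigroup (R : realType) (tk : time_kind) (V : metricType R)
    (S : R -> V -> V) : Prop :=
  (forall x, S 0 x = x) /\
  (forall t s, time_set tk t -> time_set tk s ->
    forall x, S t (S s x) = S (t + s) x).

Definition metric_bounded (R : realType) (V : metricType R) (B : set V) : Prop :=
  exists M : R, forall x y, B x -> B y -> mdist x y <= M.

Definition is_seminorm (R : realType) (Z : normedModType R) (p : Z -> R) : Prop :=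
  [/\ forall z, 0 <= p z,
      forall (c : R) z, p (c *: z) = `|c| * p z
    & forall z w, p (z + w) <= p z + p w].

Definition compact_seminorm (R : realType) (Z : normedModType R) (p : Z -> R)
  : Prop :=
  is_seminorm p /\
  (forall z : nat -> Z, bounded_fun z ->
    exists2 f : nat -> nat, {homo f : m n / (m < n)%N} &
      p (z (f jl.1) - z (f jl.2)) @[jl --> (\oo, \oo)] --> 0).

(* [K] is only constrained on [B], so taking it defined on all of [V] is
   harmless ([Z] is inhabited by [0]). *)
Definition quasi_stable (R : realType) (V : metricType R) (S : R -> V -> V)
    (B : set V) (T : R) (Z : normedModType R) (nZ : Z -> R) (eta kappa : R)
  : Prop :=
  [/\ 0 <= eta < 1, 0 < kappa &
      exists K : V -> Z, forall x y, B x -> B y ->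
        `|K x - K y| <= kappa * mdist x y /\
        mdist (S T x) (S T y) <= eta * mdist x y + nZ (K x - K y)].

(* A supremum of cardinalities, hence [+oo] or a natural number; in the latter
   case it is attained, i.e. a maximum. *)
Definition max_separated_card (R : realType) (Z : normedModType R)
    (nZ : Z -> R) (mu : R) : \bar R :=
  ereal_sup [set counting U | U in [set U : set Z |
    U `<=` [set z | `|z| <= 1] /\
    forall x y, U x -> U y -> x <> y -> mu <= nZ (x - y)]].

(* The value is [+oo] when no finite cover exists, otherwise a natural number. *)
Definition covering_number (R : realType) (V : metricType R)
    (G : set V) (eps : R) : \bar R :=
  ereal_inf [set counting C | C in [set C : set V |
    C `<=` G /\ G `<=` \bigcup_(c in C) [set x | mdist c x < eps]]].

(* Main.v *)
Require Import Defs.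
From mathcomp Require Import ring.
(** Let [mu = sigma / (2 kappa)].  Colouring the unit ball of [Z] by a nearest
    point of a maximal [mu]-separated set uses [h] colours, and points of the
    same colour are within [2 mu = sigma / kappa] for the compact seminorm.  If a
    piece of [S(kT)B] has diameter at most [rho], then its image under [K] lies
    in a ball of radius [kappa rho]; the rescaled colouring splits the piece into
    [h] parts on which the seminorm of [K x - K y] is at most [sigma rho], and by
    quasi-stability [S T] maps each part to a set of diameter at most
    [(eta + sigma) rho].  Tracking diameters rather than radii of balls is what
    gives the factor [q] without a loss of 2.  Starting from [B], one obtains
    [h^k] pieces of diameter at most [q^k diam B]. *)

Set Implicit Arguments.
Unset Strict Implicit.
Unset Printing Implicit Defensive.

Import Order.TTheory GRing.Theory Num.Theory.
Local Open Scope classical_set_scope.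
Local Open Scope ring_scope.

Lemma counting_le_size (R : realType) (T : choiceType) (A : set T) (s : seq T) :
  A `<=` [set` s] -> (counting A <= (size s)%:R%:E :> \bar R)%E.
Proof.
move=> As; have finA : finite_set A by exact: sub_finite_set As (finite_seq s).
rewrite /counting; case: asboolP => // _; rewrite lee_fin ler_nat.
apply: uniq_leq_size; first exact: finmap.fset_uniq.
by move=> x; rewrite in_fset_set// inE => /As.
Qed.

Lemma counting_uniq (R : realType) (T : choiceType) (s : seq T) :
  uniq s -> counting [set` s] = (size s)%:R%:E :> \bar R.
Proof.
move=> us; have fins : finite_set [set` s] by exact: finite_seq.
rewrite /counting; case: asboolP => // _; congr (_%:R%:E).
apply/perm_size/uniq_perm => //.
by move=> x; rewrite in_fset_set//; apply/idP/idP; rewrite inE.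
Qed.

(** An infinite set has finite subsets of every size, so a uniform bound on the finite ones already
    rules out the value [+oo]. *)
Lemma sub_counting_le (R : realType) (T : choiceType) (A : set T) (n : nat) :
  (forall s : seq T, uniq s -> [set` s] `<=` A -> (size s <= n)%N) ->
  (counting A <= n%:R%:E :> \bar R)%E.
Proof.
move=> sub_n; rewrite /counting; case: asboolP => [finA|infA].
  rewrite lee_fin ler_nat; apply: sub_n; first exact: finmap.fset_uniq.
  by move=> x /=; rewrite in_fset_set// inE.
have [C CA] := infinite_set_fset n.+1 infA.
by rewrite ltnNge sub_n//; exact: finmap.fset_uniq.
Qed.

Section seminorm.
Context {R : realType} {Z : normedModType R} (p : Z -> R).
Hypothesis p_seminorm : is_seminorm p.

Lemma seminormN z : p (- z) = p z.
Proof. by case: p_seminorm => _ pZ _; rewrite -scaleN1r pZ normrN1 mul1r. Qed.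

Lemma seminorm_distC z w : p (z - w) = p (w - z).
Proof. by rewrite -seminormN opprB. Qed.

Lemma seminorm0 : p 0 = 0.
Proof. by case: p_seminorm => _ pZ _; rewrite -(scale0r 0) pZ normr0 mul0r. Qed.

Lemma seminorm_triangle x z w : p (z - w) <= p (z - x) + p (w - x).
Proof.
case: p_seminorm => _ _ pD.
by rewrite (seminorm_distC w x) -[z - w](subrKA x) pD.
Qed.

End seminorm.

Definition separated_in_ball (R : realType) (Z : normedModType R) (p : Z -> R)
    (mu : R) (U : set Z) :=
  U `<=` [set z | `|z| <= 1] /\
  forall x y, U x -> U y -> x <> y -> mu <= p (x - y).

Section compact_seminorm.
Context {R : realType} {Z : normedModType R} (p : Z -> R).
Hypothesis p_compact : compact_seminorm p.

Let p_seminorm : is_seminorm p. Proof. by case: p_compact. Qed.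

(** Without a finite net, a greedy choice yields a sequence in the unit ball whose terms are
    pairwise at [p]-distance at least [mu], so no subsequence can be [p]-Cauchy. *)
Lemma compact_seminorm_totally_bounded (mu : R) : 0 < mu ->
  exists s : seq Z, forall z, `|z| <= 1 -> exists2 x, x \in s & p (z - x) < mu.
Proof.
move=> mu0; apply: contrapT => /forallNP nocover.
have far (s : seq Z) : exists z, `|z| <= 1 /\ forall x, x \in s -> mu <= p (z - x).
  apply: contrapT => /forallNP nofar; apply: (nocover s) => z z1.
  apply: contrapT => /forall2NP nx; apply: (nofar z); split=> // x xs.
  by rewrite leNgt; apply/negP; case: (nx x).
have [next nextP] := choice far.
(* [l n] lists the first [n] terms, and [u n] is chosen far from all of them. *)
pose l n := iter n (fun s => next s :: s) [::].
pose u n := next (l n).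
have u_l i j : (i < j)%N -> u i \in l j.
  elim: j => // j IHj; rewrite ltnS leq_eqVlt inE => /orP[/eqP->|/IHj ->].
    by rewrite eqxx.
  by rewrite orbT.
have [|f f_incr] := p_compact.2 u.
  exists 1; split=> // M M1 z _ /=.
  exact: le_trans (nextP (l z)).1 (ltW M1).
move=> /cvgr0Pnorm_lt /(_ _ mu0) [[A1 A2] /= [[N1 _ A1N] [N2 _ A2N]] Asub].
pose i := maxn N1 N2.
(* Consecutive indices suffice, the later one first: as [f] is increasing, [u (f i)] belongs to the
   list from which [u (f i.+1)] was chosen far. *)
have := Asub (i.+1, i) (conj (A1N _ _) (A2N _ _)) => /=.
rewrite (leq_trans (leq_maxl _ _) (leqnSn _)) leq_maxr => /(_ isT isT).
rewrite ltNge; case: p_seminorm => p0 _ _; rewrite ger0_norm//.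
by rewrite (nextP _).2// u_l// f_incr.
Qed.

(** Pigeonhole on a finite [mu / 2]-net: two points sharing a net point are less than [mu] apart, so
    a separated list injects into the net. *)
Lemma separated_size_bound (mu : R) : 0 < mu ->
  exists N : nat, forall s : seq Z, uniq s -> separated_in_ball p mu [set` s] ->
    (size s <= N)%N.
Proof.
move=> mu0; have mu2 : 0 < mu / 2 by rewrite divr_gt0.
have [t tP] := compact_seminorm_totally_bounded mu2.
have nearP z : exists x, `|z| <= 1 -> x \in t /\ p (z - x) < mu / 2.
  have [z1|] := boolP (`|z| <= 1); last by exists 0.
  by have [x xt px] := tP _ z1; exists x.
have [c cP] := choice nearP.
exists (size t) => s us [s1 ssep]; rewrite -(size_map c s).
apply: uniq_leq_size; last first.
  by move=> _ /mapP[z zs ->]; case: (cP z) => //; exact: s1.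
rewrite map_inj_in_uniq// => x y xs ys cxy; apply: contrapT => xy.
have [_ cx] := cP x (s1 _ xs); have [_ cy] := cP y (s1 _ ys).
have := ssep _ _ xs ys xy; rewrite leNgt => /negP; apply.
rewrite (le_lt_trans (seminorm_triangle p_seminorm (c x) x y))//.
by rewrite (splitr mu) ltrD// cxy.
Qed.

(** A separated list of maximal size is a [mu]-net of the ball. The colour of a point is the index
    of a list entry within [mu] of it, and the triangle inequality through that entry gives
    [mu + mu]. *)
Lemma max_separated_card_coloring (mu : R) : 0 < mu ->
  exists2 m : nat, max_separated_card p mu = m%:R%:E &
    exists c : Z -> 'I_m, forall z w, `|z| <= 1 -> `|w| <= 1 -> c z = c w ->
      p (z - w) <= mu + mu.
Proof.
move=> mu0; have [N NP] := separated_size_bound mu0.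
pose P n := `[< exists s : seq Z,
  [/\ uniq s, separated_in_ball p mu [set` s] & size s = n] >].
have Pub n : P n -> (n <= N)%N by move=> /asboolP[s [us ss <-]]; exact: NP.
have sep_cons z (s : seq Z) : `|z| <= 1 -> separated_in_ball p mu [set` s] ->
    (forall x, x \in s -> mu <= p (z - x)) ->
    separated_in_ball p mu [set` z :: s].
  move=> z1 [s1 ssep] zs; split=> [x|x y] /=; rewrite inE.
    by move=> /orP[/eqP->//|/s1].
  rewrite inE => /orP[/eqP->|xs] /orP[/eqP->|ys] // xy.
  - exact: zs.
  - by rewrite seminorm_distC//; exact: zs.
  - exact: ssep.
(* The singleton of 0 forces [m] to be positive, which leaves a default colour for points outside
   the ball. *)
have P1 : P 1%N.
  by apply/asboolP; exists [:: 0]; split=> //; apply: sep_cons; rewrite ?normr0.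
have Pex : exists n, P n by exists 1%N.
case: (ex_maxnP Pex Pub) => m /asboolP[s [us ssep sm]] m_max.
have net z : exists i : 'I_m, `|z| <= 1 -> p (z - s`_i) < mu.
  have m_gt0 : (0 < m)%N by exact: m_max.
  have [z1|] := boolP (`|z| <= 1); last by exists (Ordinal m_gt0).
  suff [x xs px] : exists2 x, x \in s & p (z - x) < mu.
    have xm : (index x s < m)%N by rewrite -sm index_mem.
    by exists (Ordinal xm) => _; rewrite /= nth_index.
  apply: contrapT => /forall2NP nx.
  have far x : x \in s -> mu <= p (z - x).
    by move=> xs; rewrite leNgt; apply/negP; case: (nx x).
  (* A point far from all of [s] could be added to it, against maximality; it is not already in [s],
     since [p 0 = 0 < mu]. *)
  have : (m.+1 <= m)%N.
    apply: m_max; apply/asboolP; exists (z :: s); split=> /=; last by rewrite sm.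
      rewrite us andbT; apply/negP => /far.
      by rewrite subrr seminorm0// leNgt mu0.
    exact: sep_cons.
  by rewrite ltnn.
exists m.
  apply/eqP; rewrite eq_le; apply/andP; split.
    apply: ge_ereal_sup => _ [U [U1 Usep] <-]; apply: sub_counting_le => t ut tU.
    apply: m_max; apply/asboolP; exists t; split=> //.
    by split=> [x /tU/U1//|x y /tU xU /tU yU]; exact: Usep.
  by apply: ereal_sup_ubound; exists [set` s] => //; rewrite counting_uniq// sm.
have [c cP] := choice net; exists c => z w z1 w1 czw.
rewrite (le_trans (seminorm_triangle p_seminorm s`_(c z) z w))//.
by rewrite lerD// ltW// ?cP// czw cP.
Qed.

End compact_seminorm.

Lemma time_setMn (R : realType) (tk : time_kind) (T : R) (k : nat) :
  time_set tk T -> time_set tk (k%:R * T).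
Proof.
case: tk => /=; first by move=> T0; rewrite mulr_ge0.
by move=> [n _ <-]; exists (k * n)%N => //; rewrite natrM.
Qed.

Lemma covering_number_le_card (R : realType) (V : metricType R) (f : V -> V)
    (B : set V) (C : finType) (c : V -> C) (eps : R) :
  B !=set0 ->
  (forall x y, B x -> B y -> c x = c y -> mdist (f x) (f y) < eps) ->
  (covering_number (f @` B) eps <= #|C|%:R%:E)%E.
Proof.
move=> [w0 Bw0] cP; pose r i := xget w0 [set x | B x /\ c x = i].
have Br i : B (r i) by rewrite /r; case: xgetP => [x -> []|].
have cr x : B x -> c (r (c x)) = c x.
  move=> Bx; suff [] : [set y | B y /\ c y = c x] (r (c x)) by [].
  by apply: xgetPex; exists x.
pose D := [set` [seq f (r i) | i <- enum C]].
apply: (@le_trans _ _ (counting D)).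
  apply: ereal_inf_lbound; exists D => //; split.
    by move=> _ /mapP[i _ ->]; exists (r i).
  move=> _ [x Bx <-]; exists (f (r (c x))) => /=.
    by apply/mapP; exists (c x); rewrite ?mem_enum.
  by apply: cP => //; exact: cr.
apply: le_trans (counting_le_size _ (@subset_refl _ D)) _.
by rewrite size_map -cardE.
Qed.

(** The colours sit on the points of [B], with [g] in the role of S(kT), so that a piece of S(kT)B
    is the image of a colour class and refining it means adding a second colour coordinate. *)
Lemma quasi_stable_refine_coloring (R : realType) (V : metricType R)
    (Z : normedModType R) (p : Z -> R) (F : V -> V) (K : V -> Z) (B : set V)
    (eta kappa sigma : R) (m : nat) (cZ : Z -> 'I_m) :
  is_seminorm p -> B !=set0 -> 0 <= eta -> 0 < kappa ->
  (forall x y, B x -> B y -> `|K x - K y| <= kappa * mdist x y /\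
     mdist (F x) (F y) <= eta * mdist x y + p (K x - K y)) ->
  (forall z w, `|z| <= 1 -> `|w| <= 1 -> cZ z = cZ w ->
     p (z - w) <= sigma / kappa) ->
  forall (g : V -> V) (C : finType) (c : V -> C) (rho : R),
  0 < rho -> (forall x, B x -> B (g x)) ->
  (forall x y, B x -> B y -> c x = c y -> mdist (g x) (g y) <= rho) ->
  exists c' : V -> C * 'I_m, forall x y, B x -> B y -> c' x = c' y ->
    mdist (F (g x)) (F (g y)) <= (eta + sigma) * rho.
Proof.
move=> [_ pZ _] [w0 Bw0] eta0 kappa0 KP cZP g C c rho rho0 Bg cP.
have kr0 : 0 < kappa * rho by rewrite mulr_gt0.
pose r i := xget w0 [set y | B y /\ c y = i].
have rP x : B x -> B (r (c x)) /\ c (r (c x)) = c x.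
  move=> Bx; suff : [set y | B y /\ c y = c x] (r (c x)) by [].
  by apply: xgetPex; exists x.
(* Centring at the representative of the class and rescaling brings the image under [K] into the
   unit ball; in [e x - e y] the common centre cancels. *)
pose e x := (kappa * rho)^-1 *: (K (g x) - K (g (r (c x)))).
have e1 x : B x -> `|e x| <= 1.
  move=> Bx; have [Br cr] := rP _ Bx.
  rewrite normrZ gtr0_norm ?invr_gt0// ler_pdivrMl// mulr1.
  rewrite (le_trans (KP _ _ (Bg _ Bx) (Bg _ Br)).1)// ler_pM2l//.
  by apply: cP => //; rewrite cr.
exists (fun x => (c x, cZ (e x))) => x y Bx By [cxy exy].
have := cZP _ _ (e1 _ Bx) (e1 _ By) exy.
rewrite /e cxy -scalerBr opprB addrA subrK pZ gtr0_norm ?invr_gt0// ler_pdivrMl//.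
have -> : kappa * rho * (sigma / kappa) = sigma * rho.
  by field; rewrite gt_eqF.
move=> pxy; rewrite (le_trans (KP _ _ (Bg _ Bx) (Bg _ By)).2)// mulrDl lerD//.
by rewrite ler_wpM2l// cP.
Qed.

Theorem theorem3p4 (R : realType) (tk : time_kind) (V : metricType R)
    (S : R -> V -> V) (T : R) (B : set V)
    (Z : normedModType R) (nZ : Z -> R) (eta kappa : R) :
  semigroup tk S ->
  time_set tk T -> 0 < T ->
  B !=set0 -> metric_bounded B -> S T @` B `<=` B ->
  compact_seminorm nZ ->
  quasi_stable S B T nZ eta kappa ->
  forall sigma : R, 0 < sigma < 1 - eta ->
  let q := eta + sigma in
  let h := max_separated_card nZ (sigma / (2 * kappa)) in
  h \is a fin_num /\
  exists (k0 : nat) (a b : R),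
    [/\ (0 < k0)%N, 0 < a, 0 < b &
        forall k : nat, (k0 <= k)%N ->
          (covering_number (S (k%:R * T)%R @` B) (a * q ^+ k)%R
             <= b%:E * h ^+ k)%E].
Proof.
move=> [S0 SD] Ttime T0 B0 [M MP] SB nZ_compact [/andP[eta0 _] kappa0 [K KP]].
move=> sigma /andP[sigma0 _] q h.
have mu0 : 0 < sigma / (2 * kappa) by rewrite divr_gt0// mulr_gt0.
have [m hm [cZ cZP]] := max_separated_card_coloring nZ_compact mu0.
have mu2 : sigma / (2 * kappa) + sigma / (2 * kappa) = sigma / kappa.
  by field; rewrite gt_eqF.
rewrite mu2 in cZP.
have q0 : 0 < q by rewrite ltr_wpDl.
(* A strictly positive diameter bound, even when [B] is a single point: the refinement step divides
   by it. *)
pose M1 := `|M| + 1; have M10 : 0 < M1 by rewrite ltr_wpDl.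
have SSn k x : S (k.+1%:R * T) x = S T (S (k%:R * T) x).
  by rewrite SD//; [rewrite mulrSr mulrDl mul1r addrC | exact: time_setMn].
have BS k x : B x -> B (S (k%:R * T) x).
  move=> Bx; elim: k => [|k IHk]; first by rewrite mul0r S0.
  by rewrite SSn; apply: SB; exists (S (k%:R * T) x).
have coloring k : exists2 C : finType, #|C| = (m ^ k)%N &
    exists c : V -> C, forall x y, B x -> B y -> c x = c y ->
      mdist (S (k%:R * T) x) (S (k%:R * T) y) <= q ^+ k * M1.
  elim: k => [|k [C cardC [c cP]]].
    exists unit; first by rewrite card_unit.
    exists (fun=> tt) => x y Bx By _; rewrite mul0r !S0 mul1r.
    by rewrite (le_trans (MP _ _ Bx By))// (le_trans (ler_norm _))// lerDl.
  have rho0 : 0 < q ^+ k * M1 by rewrite mulr_gt0// exprn_gt0.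
  have [c' c'P] := quasi_stable_refine_coloring nZ_compact.1 B0 eta0 kappa0 KP
    cZP rho0 (BS k) cP.
  exists (C * 'I_m)%type; first by rewrite card_prod card_ord cardC expnSr.
  by exists c' => x y Bx By cxy; rewrite !SSn exprS -mulrA c'P.
split; first by rewrite /h hm.
(* The covering balls are open while the diameters are only at most [q ^+ k * M1], so [a] must
   exceed [M1] strictly. *)
exists 1%N, (M1 + 1), 1; split=> [||//|k _]; first by [].
  by rewrite addr_gt0.
have [C cardC [c cP]] := coloring k.
rewrite mul1e /h hm -EFin_expe -natrX -cardC.
apply: (covering_number_le_card (c := c)) => // x y Bx By cxy.
by rewrite (le_lt_trans (cP _ _ Bx By cxy))// mulrC ltr_pM2r ?exprn_gt0// ltrDl.
Qed.
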